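(* Let $0<\alpha<1$, $\nu>0$, $T>1$, let $G\subset\mathbb{R}^n$ be a bounded domain with smooth boundary $\partial G$, and put $\Omega=G\times(1,T]$. Let $F$ (on $\overline\Omega$), $\varphi$ (on $\bar G$) and $\psi$ (on $\partial G\times[1,T]$) be continuous. Then the problem $$D_{*,t}^{\alpha}u(x,t)=\nu\Delta_x u(x,t)+F(x,t),\quad (x,t)\in\Omega,$$ $$u(x,1)=\varphi(x),\ x\in\bar G,\qquad u(x,t)=\psi(x,t),\ x\in\partial G,\ 1\le t\le T,$$ has at most one solution.
   Context: $\Delta_x u=\sum_{j=1}^n\partial^2u/\partial x_j^2$, $\overline\Omega=\bar G\times[1,T]$, and $D_{*,t}^{\alpha}$ is the Hadamard-type fractional derivative in $t$ with base point $1$: $$D_{*,t}^{\alpha}u(x,t)=\frac{1}{\Gamma(1-\alpha)}\int_1^t\left(\log\frac{t}{s}\right)^{-\alpha}\frac{\partial u}{\partial s}(x,s)\,ds .$$ Solutions are classical: $u\in C(\overline\Omega)$ is real-valued, $u(\cdot,t)\in C^2(G)$ for each $t\in(1,T]$, $u(x,\cdot)\in W^1_2([1,T])$ (Sobolev space) for each $x\in G$, the integral defining $D_{*,t}^{\alpha}u(x,t)$ converges absolutely at every $(x,t)\in\Omega$, and the equation holds at every point of $\Omega$. *)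

(* Defs.v *)
From HB Require Import structures.
From mathcomp Require Import all_boot all_order all_algebra.
From mathcomp Require Import all_classical all_reals all_analysis.
Set Implicit Arguments.
Unset Strict Implicit.
Unset Printing Implicit Defensive.
Import Order.TTheory GRing.Theory Num.Theory.
Import numFieldNormedType.Exports.
Local Open Scope classical_set_scope.
Local Open Scope ring_scope.

(* Points of R^n are row vectors 'rV[R]_n; their topology, coming from the
   sup norm, is the Euclidean one. *)

Section SpaceDerivatives.
Context {R : realType} {n : nat}.
Implicit Types (f : 'rV[R]_n -> R) (U G : set 'rV[R]_n).

Definition partial (i : 'I_n) f : 'rV[R]_n -> R := 'D_(delta_mx 0 i) f.

(* The last index of s is differentiated first. *)
Definition iter_partial (s : seq 'I_n) f : 'rV[R]_n -> R := foldr partial f s.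

Definition laplacian f (x : 'rV[R]_n) : R :=
  \sum_(j < n) partial j (partial j f) x.

(* f is of class C^k on the open set U.  The total operator 'D_v has a junk
   value where the limit does not exist, hence the derivability clause. *)
Definition class_C (k : nat) U f : Prop :=
  forall s : seq 'I_n, (size s <= k)%N -> forall x, U x ->
    {for x, continuous (iter_partial s f)} /\
    ((size s < k)%N ->
      forall i, derivable (iter_partial s f) x (delta_mx 0 i)).

Definition smooth_on U f : Prop := forall k, class_C k U f.

Definition boundary G : set 'rV[R]_n := closure G `\` interior G.

(* rho is a local defining function; as its gradient does not vanish near p,
   boundary G is the hypersurface rho = 0 near p, with G on one side of it. *)
Definition smooth_boundary G : Prop :=
  forall p, boundary G p -> exists U rho,
    [/\ open U, U p, smooth_on U rho,
        rho p = 0 /\ (exists i, partial i rho p != 0) &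
        G `&` U = [set x | U x /\ rho x < 0]].

Definition bounded_domain G : Prop :=
  [/\ open G, connected G, G !=set0 & bounded_set G].

End SpaceDerivatives.

Section TimeDerivatives.
Context {R : realType}.
Local Notation mu := (@lebesgue_measure R).
Implicit Types (a b t : R) (f g phi : R -> R).

(* phi belongs to C_c^oo(]a, b[). *)
Definition test_function a b phi : Prop :=
  (forall k x, derivable (derive1n k phi) x 1) /\
  closure [set x | phi x != 0] `<=` `]a, b[.

Definition square_integrable a b f : Prop := (f \_ `[a, b]) \in Lfun mu 2%:E.

(* g represents the weak derivative of f on ]a, b[ and is in L^2. *)
Definition is_sobolev_derivative a b f g : Prop :=
  square_integrable a b g /\
  forall phi, test_function a b phi ->
    \int[mu]_(s in `[a, b]) (f s * derive1 phi s) =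
    - \int[mu]_(s in `[a, b]) (g s * phi s).

Definition sobolev_W12 a b f : Prop :=
  square_integrable a b f /\ exists g, is_sobolev_derivative a b f g.

(* A representative of the weak derivative, which is unique up to a.e.
   equality on [a, b]; the integrals below do not depend on the choice. *)
Definition sobolev_derivative a b f : R -> R :=
  xget (cst 0) [set g | is_sobolev_derivative a b f g].

Definition euler_gamma (z : R) : R :=
  \int[mu]_(s in `]0, +oo[) (s `^ (z - 1) * expR (- s)).

(* The integrand of the Hadamard-type derivative, for f in W^1_2([1, T]); at
   s = t it has the value 0, as 0 `^ (- alpha) = 0. *)
Definition hadamard_integrand (alpha T : R) f t (s : R) : R :=
  ln (t / s) `^ (- alpha) * sobolev_derivative 1 T f s.

Definition hadamard_derivative (alpha T : R) f t : R :=
  (euler_gamma (1 - alpha))^-1 *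
  \int[mu]_(s in `[1, t]) hadamard_integrand alpha T f t s.

End TimeDerivatives.

Section Problem.
Context {R : realType} {n : nat}.

(* Functions of (x, t) are total; only their values on closure G x [1, T]
   matter. *)
Definition continuous_on_cylinder (A : set 'rV[R]_n) (T : R)
    (u : 'rV[R]_n -> R -> R) : Prop :=
  {within A `*` `[1, T], continuous (fun p : 'rV[R]_n * R => u p.1 p.2)}.

Definition classical_solution (alpha nu T : R) (G : set 'rV[R]_n)
    (F : 'rV[R]_n -> R -> R) (phi : 'rV[R]_n -> R) (psi : 'rV[R]_n -> R -> R)
    (u : 'rV[R]_n -> R -> R) : Prop :=
  continuous_on_cylinder (closure G) T u /\
  (forall t, 1 < t <= T -> class_C 2 G (fun x => u x t)) /\
  (forall x, G x -> sobolev_W12 1 T (u x)) /\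
  (forall x t, G x -> 1 < t <= T ->
    (@lebesgue_measure R).-integrable `[1, t]
      (EFin \o hadamard_integrand alpha T (u x) t)) /\
  (forall x t, G x -> 1 < t <= T ->
    hadamard_derivative alpha T (u x) t =
    nu * laplacian (fun y => u y t) x + F x t) /\
  (forall x, closure G x -> u x 1 = phi x) /\
  (forall x t, boundary G x -> 1 <= t <= T -> u x t = psi x t).

End Problem.

(* Main.v *)
Require Import Defs.
From mathcomp Require Import all_boot all_order all_algebra.
From mathcomp Require Import all_classical all_reals all_analysis.
From mathcomp Require Import measurable_realfun lra ring.
Import Order.TTheory GRing.Theory Num.Theory.
Import numFieldNormedType.Exports.
Local Open Scope classical_set_scope.
Local Open Scope ring_scope.

(** Why the solution is unique.  Let w be the difference of two solutions, and
    suppose that it is positive somewhere.  It vanishes initially and on the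
    boundary, so its maximum over the compact set closure G x [1, T] is positive
    and attained at some x0 in G and some t0 > 1.  There the laplacian of w is
    nonpositive ([laplacian_le_at_max]).  The fractional derivative of w, on the
    other hand, is strictly positive ([hadamard_derivative_lt]): formally, an
    integration by parts gives, with k s = log(t0/s)^(-alpha),
      int_1^t0 k(s) w'(s) ds
        = k(1) (w(t0) - w(1)) + int_1^t0 k'(s) (w(t0) - w(s)) ds,
    where k > 0, k' >= 0 and w(t0) is maximal.  As w solves the homogeneous
    equation, this is a contradiction, and exchanging the two solutions gives
    the equality.

    The work lies in making this rigorous when w'(s) is only a weak derivative
    and k is singular at t0.  Two facts replace the integration by parts.  A
    continuous function whose weak derivative is integrable is the integral of
    that derivative ([Rintegral_weak_derivative]); this is obtained by testing
    against explicit smooth plateau functions that tend to the indicator of an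
    interval.  And if all the tail integrals of g over [r, t0] are nonnegative,
    so is the integral of g against any nonnegative nondecreasing weight for
    which it converges ([Rintegral_nondecreasing_weight_ge0]); this is applied to
    k - k(1).

    The constant 1 / Gamma(1 - alpha) must be known to be positive, that is, the
    Gamma integral must converge ([euler_gamma_gt0]). *)

Set Implicit Arguments.
Unset Strict Implicit.
Unset Printing Implicit Defensive.

(** * A smooth step function *)

Section SmoothStep.
Context {R : realType}.
Implicit Types (f g df : R -> R) (k n : nat) (x y : R).

(** Recursion on the derivative, rather than a condition on all the iterated
    derivatives, makes every closure property a short induction on k. *)
Fixpoint times_derivable k f : Prop :=
  if k is k'.+1 then
    (forall x, derivable f x 1) /\ times_derivable k' (derive1 f)
  else True.

Lemma times_derivableS k f df : (forall x, is_derive x 1 f (df x)) ->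
  times_derivable k df -> times_derivable k.+1 f.
Proof.
move=> fdf kdf; split=> [x|]; first by have [] := fdf x.
suff -> : derive1 f = df by [].
by apply/funext => x; rewrite derive1E; apply: derive_val.
Qed.

Lemma times_derivable_is_derive k f : times_derivable k.+1 f ->
  forall x, is_derive x 1 f (derive1 f x).
Proof. by move=> [df _] x; rewrite derive1E; apply/derivableP. Qed.

Lemma times_derivableW k f : times_derivable k.+1 f -> times_derivable k f.
Proof. by elim: k f => //= k IH f [df kf]; split => //; exact: IH. Qed.

Lemma times_derivableD k f g : times_derivable k f -> times_derivable k g ->
  times_derivable k (fun x => f x + g x).
Proof.
elim: k f g => // k IH f g kf kg.
apply: (@times_derivableS _ _ (fun x => derive1 f x + derive1 g x)) => [x|].
  have := times_derivable_is_derive kf x; have := times_derivable_is_derive kg x.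
  by move=> ? ?; exact: is_deriveD.
by apply: IH; [case: kf|case: kg].
Qed.

Lemma times_derivableM k f g : times_derivable k f -> times_derivable k g ->
  times_derivable k (fun x => f x * g x).
Proof.
elim: k f g => // k IH f g kf kg.
apply: (@times_derivableS _ _
  (fun x => f x * derive1 g x + g x * derive1 f x)) => [x|].
  have := times_derivable_is_derive kf x; have := times_derivable_is_derive kg x.
  by move=> ? ?; exact: is_deriveM.
by apply: times_derivableD; apply: IH;
  [exact: times_derivableW|case: kg|exact: times_derivableW|case: kf].
Qed.

Lemma times_derivable_comp k f g : times_derivable k f ->
  times_derivable k g -> times_derivable k (fun x => f (g x)).
Proof.
elim: k f g => // k IH f g kf kg.
apply: (@times_derivableS _ _ (fun x => derive1 f (g x) * derive1 g x)) => [x|].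
  have := times_derivable_is_derive kf (g x).
  have := times_derivable_is_derive kg x.
  by move=> ? ?; exact: is_derive1_comp.
apply: times_derivableM; last by case: kg.
by apply: IH; [case: kf|exact: times_derivableW].
Qed.

Lemma times_derivable_cst k y : times_derivable k (fun=> y).
Proof.
elim: k y => // k IH y.
by apply: (@times_derivableS _ _ (fun=> 0)) => // x; exact: is_derive_cst.
Qed.

Lemma is_derive_affine x y (s : R) : is_derive s 1 (fun s => x * s + y) x.
Proof. by apply: is_derive_eq; rewrite addr0 /GRing.scale/= mulr1. Qed.

Lemma times_derivable_affine k x y : times_derivable k (fun s => x * s + y).
Proof.
case: k => // k.
apply: (times_derivableS (is_derive_affine x y)); exact: times_derivable_cst.
Qed.

Lemma times_derivable_derive1n k f : (forall k, times_derivable k f) ->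
  forall x, derivable (derive1n k f) x 1.
Proof.
elim: k f => [f /(_ 1%N)[]//|k IH f kf x].
by rewrite derive1Sn; apply: IH => j; case: (kf j.+1).
Qed.

(** For n = 0 this is the classical smooth function that is flat at 0.  The
    powers of 1/x are carried along because they make the family closed under
    differentiation, up to linear combinations. *)
Definition flat n x := if 0 < x then expR (- x^-1) * x^-1 ^+ n else 0.

Lemma flat_ge0 n x : 0 <= flat n x.
Proof.
rewrite /flat; case: ifPn => // x0.
by rewrite mulr_ge0 ?expR_ge0 ?exprn_ge0 ?invr_ge0 ?ltW.
Qed.

Lemma flat_gt0 n x : 0 < x -> 0 < flat n x.
Proof.
by move=> x0; rewrite /flat x0 mulr_gt0 ?expR_gt0 ?exprn_gt0 ?invr_gt0.
Qed.

Lemma flat0 n x : x <= 0 -> flat n x = 0.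
Proof. by rewrite /flat leNgt => /negbTE ->. Qed.

(** With y = 1/x, the term of order n + 1 of the exponential series gives
    exp y >= y^(n+1) / (n+1)!, whence y^n exp(-y) <= (n+1)! / y. *)
Lemma flat_le n x : flat n x <= n.+1`!%:R * `|x|.
Proof.
have [x0|x0] := leP x 0; first by rewrite flat0 // mulr_ge0.
rewrite /flat x0 gtr0_norm // expRN ler_pdivrMl ?expR_gt0 //.
have y0 : 0 <= x^-1 by rewrite invr_ge0 ltW.
have := expR_ge1Dxn n y0.
rewrite -(ler_pM2r (mulr_gt0 (_ : 0 < n.+1`!%:R) x0)); last first.
  by rewrite ltr0n fact_gt0.
apply: le_trans.
rewrite mulrDl mul1r.
have -> : x^-1 ^+ n.+1 / n.+1`!%:R * (n.+1`!%:R * x) = x^-1 ^+ n.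
  rewrite mulrA divfK; last by rewrite pnatr_eq0 -lt0n fact_gt0.
  by rewrite exprSr -mulrA mulVf ?mulr1 // gt_eqF.
by rewrite lerDr mulr_ge0 // ltW.
Qed.

Lemma flat_continuous0 n : {for 0, continuous (flat n)}.
Proof.
apply/cvgrPdist_le => e e0.
rewrite flat0 //; near=> x.
rewrite sub0r normrN ger0_norm ?flat_ge0 //.
apply: le_trans (flat_le n x) _.
rewrite mulrC -ler_pdivlMr ?ltr0n ?fact_gt0 //.
near: x.
have {}e0 : 0 < e / n.+1`!%:R by rewrite divr_gt0 // ltr0n fact_gt0.
exact: (@nbhs0_le R R _ e0).
Unshelve. all: by end_near. Qed.

(** At 0 the difference quotient of flat n is flat n.+1, so differentiability
    there is the continuity of the next function of the family. *)
Lemma is_derive_flat n x :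
  is_derive x 1 (flat n) (flat n.+2 x - n%:R * flat n.+1 x).
Proof.
have [x0|x0|->] := ltgtP x 0.
- rewrite !flat0 ?ltW // mulr0 subr0.
  apply: (@near_eq_is_derive _ _ _ (fun=> 0)).
  by near=> y; rewrite flat0 // ltW //; near: y; exact: lt_nbhsl.
- apply: (@near_eq_is_derive _ _ _ (fun x => expR (- x^-1) * x^-1 ^+ n)).
    by near=> y; rewrite /flat ifT //; near: y; exact: lt_nbhsr.
  have xN0 : x != 0 by rewrite gt_eqF.
  have dV : is_derive x 1 (fun x : R => x^-1) (- x ^- 2).
    by apply: is_derive_eq; first exact: is_deriveV; rewrite /GRing.scale/= mulr1.
  have dE : is_derive x 1 (fun x : R => expR (- x^-1)) (expR (- x^-1) * x ^- 2).
    by apply: is_derive_eq; rewrite opprK.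
  have -> : (fun x1 : R => expR (- x1^-1) * x1^-1 ^+ n) =
      (fun x1 => expR (- x1^-1)) * (fun x1 => x1^-1) ^+ n.
    by apply/funext => y; rewrite exprfctE.
  apply: (is_derive_eq (is_deriveM dE (is_deriveX n dV))).
  rewrite exprfctE.
  rewrite /flat x0 /GRing.scale/= -exprVn.
  case: n => [|n]; first by rewrite mulr0n; ring.
  rewrite -mulr_natl !exprS; ring.
- rewrite !flat0 // mulr0 subr0.
  apply/is_derive1_caratheodory; exists (flat n.+1); split.
  + move=> y; rewrite subr0 (@flat0 n 0) // subr0.
    have [y0|y0] := leP y 0; first by rewrite !flat0 // mul0r.
    by rewrite /flat y0 exprSr -!mulrA mulVf ?mulr1 // gt_eqF.
  + exact: flat_continuous0.
  + by rewrite flat0.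
Unshelve. all: by end_near. Qed.

Lemma times_derivable_flat k n : times_derivable k (flat n).
Proof.
elim: k n => // k IH n.
apply: (times_derivableS (is_derive_flat n)).
have -> : (fun x => flat n.+2 x - n%:R * flat n.+1 x) =
  (fun x => flat n.+2 x + (fun x => (- n%:R) * flat n.+1 x) x).
  by apply/funext => x; rewrite mulNr.
apply: times_derivableD => //; apply: times_derivableM => //.
exact: times_derivable_cst.
Qed.

Lemma le_flat0 x y : x <= y -> flat 0 x <= flat 0 y.
Proof.
move=> xy; have [x0|x0] := leP x 0; first by rewrite flat0 // flat_ge0.
have y0 := lt_le_trans x0 xy.
by rewrite /flat x0 y0 !expr0 !mulr1 ler_expR lerN2 lef_pV2.
Qed.

(** A smooth step obtained by composition alone, hence without dividing: for
    1 <= x the inner flat (1 - x) vanishes and the value is constant, while for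
    x <= 0 it is at least flat 0 1, so that the outer argument is nonpositive.
    The plateau value step 1 is left unnormalized. *)
Definition step x := flat 0 (flat 0 1 - flat 0 (1 - x)).

Definition dstep x := flat 2 (flat 0 1 - flat 0 (1 - x)) * flat 2 (1 - x).

Lemma is_derive_step x : is_derive x 1 step (dstep x).
Proof.
have d1 : is_derive x 1 (fun x => 1 - x) (-1).
  have := is_deriveB (is_derive_cst (1 : R) x 1) (is_derive_id x (1 : R)).
  by rewrite sub0r.
have := is_derive_flat 0 (1 - x).
have := is_derive_flat 0 (flat 0 1 - flat 0 (1 - x)).
rewrite !mul0r !subr0 => d3 d2.
have d4 := is_deriveB (is_derive_cst (flat 0 1) x (1 : R))
  (@is_derive1_comp _ (flat 0) (fun x => 1 - x) _ _ _ d2 d1).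
rewrite sub0r mulrN1 opprK in d4.
exact: (@is_derive1_comp _ (flat 0) (fun x => flat 0 1 - flat 0 (1 - x)) _ _ _
  d3 d4).
Qed.

Lemma le_step x y : x <= y -> step x <= step y.
Proof. by move=> xy; apply/le_flat0/lerB => //; apply/le_flat0/lerB. Qed.

Lemma step_eq0 x : x <= 0 -> step x = 0.
Proof.
by move=> x0; rewrite /step flat0 // subr_le0 le_flat0 // lerBrDr gerDl.
Qed.

Lemma step_eq1 x : 1 <= x -> step x = step 1.
Proof.
move=> x1; rewrite /step [flat 0 (1 - x)]flat0 ?subr_le0 // subrr.
by rewrite [flat 0 0]flat0.
Qed.

Lemma step1_gt0 : 0 < step 1.
Proof. by apply: flat_gt0; rewrite subrr [flat 0 0]flat0 // subr0 flat_gt0. Qed.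

Lemma step_ge0 x : 0 <= step x. Proof. exact: flat_ge0. Qed.

Lemma step_le1 x : step x <= step 1.
Proof. by have [/le_step //|/ltW/step_eq1->] := leP x 1. Qed.

Lemma dstep_ge0 x : 0 <= dstep x.
Proof. by rewrite mulr_ge0 // flat_ge0. Qed.

Lemma dstep_eq0 x : ~~ (0 < x < 1) -> dstep x = 0.
Proof.
rewrite negb_and -!leNgt /dstep => /orP[x0|x1].
  by rewrite flat0 ?mul0r // subr_le0 le_flat0 // lerBrDr gerDl.
by rewrite [X in _ * X]flat0 ?mulr0 // subr_le0.
Qed.

Lemma times_derivable_step k : times_derivable k step.
Proof.
apply: (@times_derivable_comp _ (flat 0) (fun x => flat 0 1 - flat 0 (1 - x))).
  exact: times_derivable_flat.
have -> : (fun x => flat 0 1 - flat 0 (1 - x)) =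
    (fun x => (fun x => -1 * x + flat 0 1) (flat 0 ((fun x => -1 * x + 1) x))).
  by apply/funext => x /=; rewrite !mulN1r addrC [- x + 1]addrC.
apply: (@times_derivable_comp _ (fun x => -1 * x + flat 0 1)
  (fun x => flat 0 (-1 * x + 1))).
  exact: times_derivable_affine.
apply: (@times_derivable_comp _ (flat 0) (fun x => -1 * x + 1)).
  exact: times_derivable_flat.
exact: times_derivable_affine.
Qed.

Lemma derivable_dstep x : derivable dstep x 1.
Proof.
have -> : dstep = derive1 step.
  by apply/funext => y; rewrite derive1E; apply/esym/derive_val/is_derive_step.
by have [_ []] := times_derivable_step 2.
Qed.

End SmoothStep.

(** * Primitives of weak derivatives *)

Section RealIntegrals.
Context {d} {T : measurableType d} {R : realType}.
Context (mu : {measure set T -> \bar R}).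
Implicit Types (D : set T) (f g h : T -> R).

Lemma Rintegrable_sub D f g : measurable D -> mu.-integrable D (EFin \o f) ->
  mu.-integrable D (EFin \o g) ->
  mu.-integrable D (EFin \o (fun s => f s - g s)).
Proof.
by move=> mD intf intg; apply: eq_integrable (integrableB mD intf intg).
Qed.

Lemma Rintegrable_add D f g : measurable D -> mu.-integrable D (EFin \o f) ->
  mu.-integrable D (EFin \o g) ->
  mu.-integrable D (EFin \o (fun s => f s + g s)).
Proof.
by move=> mD intf intg; apply: eq_integrable (integrableD mD intf intg).
Qed.

Lemma Rintegrable_scale D c f : measurable D -> mu.-integrable D (EFin \o f) ->
  mu.-integrable D (EFin \o (fun s => c * f s)).
Proof.
by move=> mD intf; apply: eq_integrable (integrableZl mD c intf).
Qed.

Lemma dominated_cvg_Rintegral D (f_ : nat -> T -> R) f h : measurable D ->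
  (forall n, measurable_fun D (f_ n)) -> measurable_fun D f ->
  (forall s, D s -> f_ n s @[n --> \oo] --> f s) ->
  mu.-integrable D (EFin \o h) ->
  (forall n s, D s -> `|f_ n s| <= h s) ->
  \int[mu]_(s in D) f_ n s @[n --> \oo] --> \int[mu]_(s in D) f s.
Proof.
move=> mD mf_ mf f_f inth f_h.
have [||||intf _ cvgI] := @dominated_convergence _ _ _ mu D mD
  (fun n => EFin \o f_ n) (EFin \o f) (EFin \o h) _ _ _ inth.
- by move=> n; exact/measurable_EFinP.
- exact/measurable_EFinP.
- by apply: aeW => s Ds; apply: cvg_EFin; [exact: nearW|exact: f_f].
- by apply: aeW => s n Ds; rewrite lee_fin f_h.
have := cvgI.
rewrite -(fineK (integrable_fin_num mD intf)).
by move=> /fine_cvgP[].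
Qed.

End RealIntegrals.

Section WeakPrimitive.
Context {R : realType}.
Local Notation mu := (@lebesgue_measure R).
Implicit Types (f g : R -> R) (a b m p q r s t : R).

Lemma is_derive_step_affine m p q s :
  is_derive s 1 (fun s => step (m * (s - p) + q)) (m * dstep (m * (s - p) + q)).
Proof.
have d : is_derive s 1 (fun s => m * (s - p) + q) m.
  have -> : (fun s => m * (s - p) + q) = (fun s => m * s + (q - m * p)).
    by apply/funext => x; ring.
  exact: is_derive_affine.
rewrite mulrC.
exact: (@is_derive1_comp _ step (fun s => m * (s - p) + q) _ _ _
  (is_derive_step _) d).
Qed.

Lemma continuous_dstep_affine m p q :
  continuous (fun s => m * dstep (m * (s - p) + q)).
Proof.
move=> s; apply: cvgM; first exact: cvg_cst.
apply: (@continuous_comp _ _ _ (fun s => m * (s - p) + q) dstep).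
  apply: cvgD; last exact: cvg_cst.
  by apply: cvgM; [exact: cvg_cst|apply: cvgB; [exact: cvg_id|exact: cvg_cst]].
by apply/differentiable_continuous/derivable1_diffP/derivable_dstep.
Qed.

Lemma Rintegral_dstep_affine a b m p q : a < b ->
  m * (a - p) + q <= 0 -> 1 <= m * (b - p) + q ->
  \int[mu]_(s in `[a, b]) (m * dstep (m * (s - p) + q)) = step 1.
Proof.
move=> ab la lb; rewrite /Rintegral.
have cstep : continuous (fun s => step (m * (s - p) + q)).
  move=> s; apply/differentiable_continuous/derivable1_diffP.
  by have [] := is_derive_step_affine m p q s.
rewrite (@continuous_FTC2 _ _ (fun s => step (m * (s - p) + q))) //.
- by rewrite (step_eq0 la) (step_eq1 lb) sube0.
- exact/continuous_subspaceT/continuous_dstep_affine.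
- split.
  + by move=> x _; have [] := is_derive_step_affine m p q x.
  + by apply: cvg_at_right_filter; exact: cstep.
  + by apply: cvg_at_left_filter; exact: cstep.
- move=> x _; rewrite derive1E; apply: derive_val.
  exact: is_derive_step_affine.
Qed.

Lemma continuous_integrable a b f : {within `[a, b], continuous f} ->
  mu.-integrable `[a, b] (EFin \o f).
Proof. by apply: continuous_compact_integrable; exact: segment_compact. Qed.

(** The rescaled derivative of the step is an approximate identity at p: it is
    nonnegative, has mass step 1, and is supported in an interval of length 1/n
    within distance (|q| + 1)/n of p.  The shift q allows the support to lie on
    one side of p, so that p may be an end point of [a, b]. *)
Lemma cvg_Rintegral_dstep a b p q f : a < b -> p \in `[a, b] ->
  {within `[a, b], continuous f} ->
  (\forall n \near \oo, n%:R * (a - p) + q <= 0 /\ 1 <= n%:R * (b - p) + q) ->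
  \int[mu]_(s in `[a, b]) (f s * (n%:R * dstep (n%:R * (s - p) + q)))
    @[n --> \oo] --> f p * step 1.
Proof.
move=> ab pab cf near_supp.
apply/cvgrPdist_le => e e0.
have e'0 : 0 < e / step 1 by rewrite divr_gt0 // step1_gt0.
have [d d0 fd] : exists2 d, 0 < d & forall s, s \in `[a, b] -> `|s - p| < d ->
    `|f s - f p| <= e / step 1.
  have /subspace_continuousP/(_ p pab)/cvgrPdist_le/(_ _ e'0) := cf.
  rewrite near_withinE => /nbhs_ballP[d /= d0 dP]; exists d => // s sab sp.
  by rewrite distrC; apply: dP => //; rewrite /ball/= distrC.
near=> n.
have n0 : 0 < n%:R :> R by near: n; exact: nbhs_infty_gtr.
have [la lb] : n%:R * (a - p) + q <= 0 /\ 1 <= n%:R * (b - p) + q by near: n.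
pose K s := n%:R * dstep (n%:R * (s - p) + q).
have K0 s : 0 <= K s by rewrite mulr_ge0 // dstep_ge0.
have cK : {within `[a, b], continuous K}.
  exact/continuous_subspaceT/continuous_dstep_affine.
have iK := continuous_integrable cK.
have IK : \int[mu]_(s in `[a, b]) K s = step 1 by exact: Rintegral_dstep_affine.
have cfK : {within `[a, b], continuous (fun s => f s * K s)}.
  by move=> s; apply: cvgM; [exact: cf|exact: cK].
have ifK := continuous_integrable cfK.
have ifpK : mu.-integrable `[a, b] (EFin \o (fun s => f p * K s)).
  by apply: continuous_integrable => s; apply: cvgM; [exact: cvg_cst|exact: cK].
rewrite -{1}IK -RintegralZl // -RintegralB //.
have mab : measurable `[a, b] by [].
have iB : mu.-integrable `[a, b] (EFin \o (fun s => f p * K s - f s * K s)).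
  exact: Rintegrable_sub.
apply: le_trans (le_normr_Rintegral _ _) _ => //.
have -> : e = \int[mu]_(s in `[a, b]) (e / step 1 * K s).
  by rewrite RintegralZl // IK divfK // gt_eqF // step1_gt0.
apply: le_Rintegral => //.
- exact: integrable_norm.
- exact: Rintegrable_scale.
move=> s sab; rewrite -mulrBl normrM (ger0_norm (K0 s)).
have [sin|sout] := boolP (0 < n%:R * (s - p) + q < 1); last first.
  by rewrite /K dstep_eq0 // !mulr0.
rewrite ler_wpM2r // distrC fd //.
have nd : (`|q| + 1) / d < n%:R by near: n; exact: nbhs_infty_gtr.
rewrite -(ltr_pM2l n0) -{1}(gtr0_norm n0) -normrM.
apply: lt_trans (_ : `|q| + 1 < _); last by rewrite -ltr_pdivrMr.
case/andP: sin => s1 s2.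
have := ler_norm q; have := ler_norm (- q); rewrite normrN => q1 q2.
by rewrite ltr_norml; apply/andP; split; lra.
Unshelve. all: by end_near. Qed.

(** A test function approximating step 1 times the indicator of ]r, t[.  The
    shifts -1 and 2 confine its two edges to [r + 1/m, r + 2/m] and
    [t - 2/m, t - 1/m]; its support is thus compact in ]r, t[, even when r or t
    is an end point of the interval on which the weak derivative is known. *)
Definition plateau r t m s := step (m * (s - r) + -1) - step (m * (s - t) + 2).

Lemma plateau_norm_le r t m s : `|plateau r t m s| <= step 1.
Proof.
rewrite ler_norml /plateau; set x := _ + -1; set y := _ + 2.
have := step_ge0 x; have := step_le1 x; have := step_ge0 y; have := step_le1 y.
by move: (step x) (step y) (step 1) => u v w; lra.
Qed.

Lemma is_derive_plateau r t m s : is_derive s 1 (plateau r t m)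
  (m * dstep (m * (s - r) + -1) - m * dstep (m * (s - t) + 2)).
Proof.
have := is_derive_step_affine m r (-1) s.
have := is_derive_step_affine m t 2 s.
by move=> ? ?; exact: is_deriveB.
Qed.

(** The condition 3 <= m (t - r) makes the rising edge begin and end no later
    than the falling one. *)
Lemma plateau_test_function a b r t m : a <= r -> t <= b -> 0 < m ->
  3 <= m * (t - r) -> test_function a b (plateau r t m).
Proof.
move=> ar tb m0 m3; split.
  move=> k x; apply: times_derivable_derive1n => {}k.
  have taff c d : times_derivable k (fun s => step (m * (s - c) + d)).
    have -> : (fun s => step (m * (s - c) + d)) =
        (fun s => step ((fun s => m * s + (d - m * c)) s)).
      by apply/funext => s /=; congr step; ring.
    apply: times_derivable_comp; first exact: times_derivable_step.
    exact: times_derivable_affine.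
  have -> : plateau r t m = (fun s => (fun s => step (m * (s - r) + -1)) s +
      (fun s => (fun=> -1) s * step (m * (s - t) + 2)) s).
    by apply/funext => s; rewrite /plateau mulN1r.
  apply: times_derivableD => //; apply: times_derivableM => //.
  exact: times_derivable_cst.
have supp : [set s | plateau r t m s != 0] `<=` `[r + m^-1, t - m^-1].
  move=> s /=; apply: contraNT; rewrite in_itv/= negb_and -!ltNge /plateau.
  have mVm : m * m^-1 = 1 by rewrite divff // gt_eqF.
  move=> /orP[|]; rewrite -(ltr_pM2l m0) ?mulrBr ?mulrDr mVm => ms.
    by rewrite !step_eq0 ?subrr //; lra.
  by rewrite !step_eq1 ?subrr //; lra.
apply: (subset_trans (closureS supp)).
rewrite -(closure_id _).1; last exact: itv_closed.
have mV0 : 0 < m^-1 by rewrite invr_gt0.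
move=> s /=; rewrite !in_itv/= => /andP[rs st]; apply/andP; split; lra.
Qed.

Lemma near_natmul_ge (c x : R) : 0 < x -> \forall n \near \oo, c <= n%:R * x.
Proof.
move=> x0; near=> n; rewrite -ler_pdivrMr //; near: n.
by apply: filterS (nbhs_infty_gtr (c / x)) => n /ltW.
Unshelve. all: by end_near. Qed.

Lemma cvg_plateau r t s : r < t ->
  plateau r t n%:R s @[n --> \oo] --> (cst (step 1) \_ `]r, t[) s.
Proof.
move=> rt; apply: cvg_near_cst; rewrite patchE /plateau; case: ifPn => [|].
  rewrite inE/= in_itv/= => /andP[rs st]; near=> n.
  have nsr : 2 <= n%:R * (s - r).
    by near: n; apply: near_natmul_ge; rewrite subr_gt0.
  have nts : 2 <= n%:R * (t - s).
    by near: n; apply: near_natmul_ge; rewrite subr_gt0.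
  by rewrite step_eq1 ?[step (_ * (s - t) + _)]step_eq0 ?subr0 //; lra.
rewrite notin_setE/= in_itv/= => /negP; rewrite negb_and -!leNgt => srt.
near=> n.
have ntr : 2 <= n%:R * (t - r).
  by near: n; apply: near_natmul_ge; rewrite subr_gt0.
case/orP: srt => [sr|ts].
  have nsr : n%:R * (s - r) <= 0 by rewrite mulr_ge0_le0 // subr_le0.
  by rewrite !step_eq0 ?subrr //; lra.
have nts : 0 <= n%:R * (s - t) by rewrite mulr_ge0 // subr_ge0.
by rewrite !step_eq1 ?subrr //; lra.
Unshelve. all: by end_near. Qed.

(** Testing the weak derivative against plateau functions of growing steepness:
    on the side of g, dominated convergence yields the integral over ]r, t[; on
    the side of f, the derivative of the plateau concentrates at r and at t with
    opposite signs.  Both limits carry the factor step 1, which cancels. *)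
Lemma Rintegral_weak_derivative a b r t f g : a <= r -> r < t -> t <= b ->
  {within `[a, b], continuous f} -> mu.-integrable `[a, b] (EFin \o g) ->
  (forall phi, test_function a b phi ->
    \int[mu]_(s in `[a, b]) (f s * derive1 phi s) =
    - \int[mu]_(s in `[a, b]) (g s * phi s)) ->
  \int[mu]_(s in `[r, t]) g s = f t - f r.
Proof.
move=> ar rt tb cf intg weak.
have ab : a < b by apply: le_lt_trans ar (lt_le_trans rt tb).
have mab : measurable (`[a, b] : set R) by [].
have lim_f : \int[mu]_(s in `[a, b]) (f s * derive1 (plateau r t n%:R) s)
    @[n --> \oo] --> f r * step 1 - f t * step 1.
  have E n : \int[mu]_(s in `[a, b]) (f s * derive1 (plateau r t n%:R) s) =
      \int[mu]_(s in `[a, b]) (f s * (n%:R * dstep (n%:R * (s - r) + -1))) -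
      \int[mu]_(s in `[a, b]) (f s * (n%:R * dstep (n%:R * (s - t) + 2))).
    have intfK p q : mu.-integrable `[a, b]
        (EFin \o (fun s => f s * (n%:R * dstep (n%:R * (s - p) + q)))).
      have cK : {within `[a, b], continuous
          (fun s => n%:R * dstep (n%:R * (s - p) + q))}.
        exact/continuous_subspaceT/continuous_dstep_affine.
      by apply: continuous_integrable => s; apply: cvgM; [exact: cf|exact: cK].
    rewrite -RintegralB //; apply: eq_Rintegral => s _; rewrite -mulrBr.
    by congr (_ * _); rewrite derive1E; apply/derive_val/is_derive_plateau.
  under eq_fun do rewrite E.
  apply: cvgB; apply: cvg_Rintegral_dstep => //.
  - by rewrite in_itv/= ar ltW // (lt_le_trans rt).
  - near=> n.
    have n0 : 0 < n%:R :> R by near: n; exact: nbhs_infty_gtr.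
    have nra : 0 <= n%:R * (r - a) by rewrite pmulr_rge0 // subr_ge0.
    have nbr : 3 <= n%:R * (b - r).
      by near: n; apply: near_natmul_ge; rewrite subr_gt0 (lt_le_trans rt).
    by split; lra.
  - by rewrite in_itv/= tb ltW // (le_lt_trans ar).
  - near=> n.
    have n0 : 0 < n%:R :> R by near: n; exact: nbhs_infty_gtr.
    have nbt : 0 <= n%:R * (b - t) by rewrite pmulr_rge0 // subr_ge0.
    have nta : 3 <= n%:R * (t - a).
      by near: n; apply: near_natmul_ge; rewrite subr_gt0 (le_lt_trans ar).
    by split; lra.
have /measurable_EFinP mg := measurable_int mu intg.
have lim_g : \int[mu]_(s in `[a, b]) (g s * plateau r t n%:R s) @[n --> \oo] -->
    step 1 * \int[mu]_(s in `[r, t]) g s.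
  have -> : step 1 * \int[mu]_(s in `[r, t]) g s =
      \int[mu]_(s in `[a, b]) (g s * (cst (step 1) \_ `]r, t[) s).
    have sub : `]r, t[ `<=` `[a, b].
      move=> s /=; rewrite !in_itv/= => /andP[rs st].
      by rewrite (le_trans ar (ltW rs)) (le_trans (ltW st) tb).
    have intg' : mu.-integrable `]r, t[ (EFin \o g) by exact: integrableS intg.
    have -> : \int[mu]_(s in `[r, t]) g s = \int[mu]_(s in `]r, t[) g s.
      by rewrite /Rintegral integral_itv_bndoo //; exact: measurable_int intg'.
    rewrite -RintegralZl // -[in LHS](setIidr sub) Rintegral_mkcondr.
    apply: eq_Rintegral => s _; rewrite !patchE; case: ifP => _ /=.
      by rewrite mulrC.
    by rewrite mulr0.
  have := @dominated_cvg_Rintegral _ _ _ mu `[a, b]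
    (fun n s => g s * plateau r t n%:R s)
    (fun s => g s * (cst (step 1) \_ `]r, t[) s) (fun s => step 1 * `|g s|) mab.
  apply.
  - move=> n; apply: measurable_funM => //.
    apply: measurable_funTS; apply: continuous_measurable_fun => s.
    apply/differentiable_continuous/derivable1_diffP.
    by have [] := is_derive_plateau r t n%:R s.
  - apply: measurable_funM => //.
    by apply: measurable_funTS; apply/measurable_restrict.
  - move=> s _; apply: cvgM; [exact: cvg_cst|exact: cvg_plateau].
  - by apply: Rintegrable_scale => //; exact: integrable_norm.
  - by move=> n s _; rewrite normrM mulrC ler_wpM2r // plateau_norm_le.
have lim_g' : \int[mu]_(s in `[a, b]) (f s * derive1 (plateau r t n%:R) s)
    @[n --> \oo] --> - (step 1 * \int[mu]_(s in `[r, t]) g s).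
  apply: cvg_trans (cvgN lim_g); apply: near_eq_cvg.
  near=> n; apply/esym/weak/plateau_test_function => //.
  - by near: n; exact: nbhs_infty_gtr.
  - by near: n; apply: near_natmul_ge; rewrite subr_gt0.
have := cvg_unique (@Rhausdorff R) lim_f lim_g'.
have := @step1_gt0 R => s0.
rewrite -mulrBl [_ * step 1]mulrC -mulrN => H.
have E := mulfI (lt0r_neq0 s0) (H _).
by rewrite -[LHS]opprK -E opprB.
Unshelve. all: by end_near. Qed.

End WeakPrimitive.

(** * Integrals against monotone weights *)

Section MonotoneWeight.
Context {R : realType}.
Local Notation mu := (@lebesgue_measure R).
Implicit Types (g h : R -> R) (a b r s : R).

Lemma upper_set_itv a b (U : set R) : U `<=` `[a, b[ ->
  (forall s s', U s -> s <= s' -> s' < b -> U s') -> U !=set0 ->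
  exists r c, a <= r < b /\ U = [set` Interval (BSide c r) (BLeft b)].
Proof.
move=> Uab upU [s0 Us0].
have lbU : lbound U a by move=> s /Uab /=; rewrite in_itv/= => /andP[].
have hiU : has_inf U by split; [exists s0|exists a].
have ltb s : U s -> s < b by move=> /Uab /=; rewrite in_itv/= => /andP[].
have infU s : U s -> inf U <= s by apply: ge_inf; exists a.
have above s : inf U < s -> s < b -> U s.
  move=> rs sb; have [s' Us' s's] := inf_lt hiU.1 rs.
  exact: upU Us' (ltW s's) sb.
exists (inf U).
have rab : a <= inf U < b.
  by rewrite lb_le_inf //= ?(le_lt_trans (infU _ Us0)) ?ltb //; exists s0.
have [Ur|Ur] := pselect (U (inf U)).
- exists true; split=> //; apply/seteqP; split=> s /=; rewrite in_itv/=.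
    by move=> Us; rewrite infU // ltb.
  by move=> /andP[rs sb]; exact: upU Ur rs sb.
- exists false; split=> //; apply/seteqP; split=> s /=; rewrite in_itv/=.
    move=> Us; rewrite ltb // andbT lt_neqAle infU // andbT.
    by apply/eqP => E; apply: Ur; rewrite E.
  by move=> /andP[rs sb]; exact: above.
Qed.

(** An up-closed subset of [a, b[ is a terminal interval, open or closed at its
    infimum, so its integral is one of the given tail integrals. *)
Lemma Rintegral_upper_set_ge0 a b g (U : set R) :
  mu.-integrable `[a, b] (EFin \o g) ->
  (forall r, a <= r < b -> 0 <= \int[mu]_(s in `[r, b]) g s) ->
  U `<=` `[a, b[ -> (forall s s', U s -> s <= s' -> s' < b -> U s') ->
  measurable U /\ 0 <= \int[mu]_(s in U) g s.
Proof.
move=> intg tail Uab upU.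
have [->|U0] := eqVneq U set0; first by rewrite Rintegral_set0.
move/set0P in U0; have [r [c [rab ->]]] := upper_set_itv Uab upU U0.
split=> //; have := tail _ rab.
have intg' : mu.-integrable `]r, b[ (EFin \o g).
  apply: integrableS intg => // s /=; rewrite !in_itv/= => /andP[rs sb].
  by rewrite (ltW sb) (le_trans _ (ltW rs)) //; case/andP: rab.
have mg := measurable_int mu intg'.
by rewrite /Rintegral integral_itv_bndoo // [in X in _ -> X]integral_itv_bndoo.
Qed.

(** The sum is the integer part of z, capped at M. *)
Lemma layer_count (M : nat) (z : R) : 0 <= z ->
  let S := \sum_(j < M) (j.+1%:R <= z)%R%:R in
  [/\ 0 <= S, S <= z & z <= M%:R -> z - 1 <= S].
Proof.
move=> z0.
suff [? ? ? ?] : let S := \sum_(j < M) (j.+1%:R <= z)%R%:R in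
  [/\ 0 <= S, S <= z, z <= M%:R -> z - 1 <= S & M%:R <= z -> S = M%:R] by [].
elim: M => [|M]; first by rewrite /= big_ord0; split=> //; lra.
rewrite /= big_ord_recr /=; set S := \sum_(_ < M) _ => -[S0 Sz zS SM].
have M1 : M.+1%:R = M%:R + 1 :> R by rewrite -natr1.
rewrite M1; have [Mz|zM] := leP (M%:R + 1) z.
  have -> : S = M%:R by apply: SM; lra.
  have -> : (nat_of_bool true)%:R = 1 :> R by [].
  by have := ler0n R M; split; lra.
by rewrite addr0; split=> //; lra.
Qed.

Lemma near_ltr_natS (x : R) : \forall n \near \oo, x < n.+1%:R.
Proof.
near=> n; apply: (@lt_trans _ _ n%:R); last by rewrite ltr_nat.
by near: n; exact: nbhs_infty_gtr.
Unshelve. all: by end_near. Qed.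

(** A nonnegative nondecreasing weight is a superposition of indicators of
    terminal intervals, and each of these integrates g to a nonnegative number.
    The superposition is discretized: h is approximated from below by 1/N times
    the number of levels j/N with 1 <= j <= N^2 that it reaches.  This converges
    pointwise, with error 1/N once h s <= N, and |h g| dominates.  It is an
    integration by parts that needs no derivative of h, and allows h to blow up
    at b. *)
Lemma Rintegral_nondecreasing_weight_ge0 a b g h :
  mu.-integrable `[a, b] (EFin \o g) ->
  (forall r, a <= r < b -> 0 <= \int[mu]_(s in `[r, b]) g s) ->
  (forall s, a <= s < b -> 0 <= h s) ->
  (forall s s', a <= s -> s <= s' -> s' < b -> h s <= h s') ->
  mu.-integrable `[a, b[ (EFin \o (fun s => h s * g s)) ->
  0 <= \int[mu]_(s in `[a, b[) (h s * g s).
Proof.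
move=> intg tail h0 hnd inthg.
have mab : measurable (`[a, b[ : set R) by [].
have intg' : mu.-integrable `[a, b[ (EFin \o g).
  apply: integrableS intg => // s /=; rewrite !in_itv/= => /andP[-> sb].
  exact: ltW.
have /measurable_EFinP mg := measurable_int mu intg'.
have /measurable_EFinP mhg := measurable_int mu inthg.
pose U c : set R := [set s | a <= s < b /\ c <= h s].
have UP c : measurable (U c) /\ 0 <= \int[mu]_(s in U c) g s.
  apply: (Rintegral_upper_set_ge0 intg tail).
    by move=> s [] /=; rewrite in_itv.
  move=> s s' [/andP[as_ sb] cs] ss' s'b; split.
    by rewrite (le_trans as_ ss').
  exact: le_trans cs (hnd _ _ as_ ss' s'b).
have mU c : measurable_fun `[a, b[ (fun s => \1_(U c) s * g s).
  apply: measurable_funM => //; apply: measurable_funTS.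
  exact: measurable_indic (UP c).1.
pose lay (n M : nat) (s : R) := n.+1%:R^-1 *
  \sum_(j < M) (\1_(U (n.+1%:R^-1 * j.+1%:R)) s : R).
have intlay n M : mu.-integrable `[a, b[ (EFin \o (fun s => lay n M s * g s)) /\
    0 <= \int[mu]_(s in `[a, b[) (lay n M s * g s).
  pose c j : R := n.+1%:R^-1 * j.+1%:R.
  have intU c' : mu.-integrable `[a, b[ (EFin \o (fun s => \1_(U c') s * g s)).
    have /measurable_EFinP mUg := mU c'.
    apply: (@le_integrable _ _ _ mu `[a, b[ mab _ (EFin \o g)) => //.
    move=> s _; rewrite /= lee_fin normrM ler_piMl // indicE.
    by case: (_ \in _); rewrite ?normr1 ?normr0.
  have [intS S0] : mu.-integrable `[a, b[ (EFin \o
        (fun s => (\sum_(j < M) (\1_(U (c j)) s : R)) * g s)) /\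
      0 <= \int[mu]_(s in `[a, b[) ((\sum_(j < M) (\1_(U (c j)) s : R)) * g s).
    elim: M => [|M [IHi IH]].
      under [X in EFin \o X]eq_fun do rewrite big_ord0 mul0r.
      under [X in _ <= X]eq_Rintegral do rewrite big_ord0 mul0r.
      split; first exact: integrable0.
      by apply: Rintegral_ge0.
    have E s : (\sum_(j < M.+1) (\1_(U (c j)) s : R)) * g s =
        (\sum_(j < M) (\1_(U (c j)) s : R)) * g s + \1_(U (c M)) s * g s.
      by rewrite big_ord_recr mulrDl.
    under [X in EFin \o X]eq_fun do rewrite E.
    under [X in _ <= X]eq_Rintegral do rewrite E.
    split; first exact: Rintegrable_add.
    rewrite RintegralD // addr_ge0 //.
    have [mUc Uc0] := UP (c M); move: Uc0.
    have sub : U (c M) `<=` `[a, b[ by move=> s []; rewrite /= in_itv.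
    rewrite -[in X in X -> _](setIidr sub) Rintegral_mkcondr.
    congr (_ <= _); apply: eq_Rintegral => s _.
    by rewrite patchE indicE; case: ifP => _; rewrite ?mul1r ?mul0r.
  have E s : lay n M s * g s =
      n.+1%:R^-1 * ((\sum_(j < M) (\1_(U (c j)) s : R)) * g s).
    by rewrite mulrA.
  under [X in EFin \o X]eq_fun do rewrite E.
  under [X in _ <= X]eq_Rintegral do rewrite E.
  split; first exact: Rintegrable_scale.
  by rewrite RintegralZl // mulr_ge0.
have layE n M s : a <= s < b -> lay n M s =
    n.+1%:R^-1 * \sum_(j < M) (j.+1%:R <= n.+1%:R * h s)%R%:R.
  move=> sab; congr (_ * _); apply: eq_bigr => j _.
  rewrite indicE -ler_pdivrMl ?ltr0Sn //; congr (nat_of_bool _)%:R.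
  by apply/idP/idP => [/set_mem[]//|cs]; exact/mem_set.
have lim : \int[mu]_(s in `[a, b[) (lay n (n.+1 ^ 2)%N s * g s) @[n --> \oo] -->
    \int[mu]_(s in `[a, b[) (h s * g s).
  have := @dominated_cvg_Rintegral _ _ _ mu `[a, b[
    (fun n s => lay n (n.+1 ^ 2)%N s * g s)
    (fun s => h s * g s) (fun s => `|h s * g s|) mab.
  apply => //.
  - move=> n; have [inl _] := intlay n (n.+1 ^ 2)%N.
    by have /measurable_EFinP := measurable_int mu inl.
  - move=> s /=; rewrite in_itv/= => sab; apply: cvgM; last exact: cvg_cst.
    have hs0 := h0 _ sab.
    apply/cvgrPdist_le => e e0; near=> n; rewrite layE //.
    have nz0 : 0 <= n.+1%:R * h s by rewrite mulr_ge0.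
    have [S0 Sz zS] := layer_count (n.+1 ^ 2) nz0.
    have n0 : 0 < n.+1%:R :> R by rewrite ltr0Sn.
    rewrite -(ler_pM2l n0) -{1}(gtr0_norm n0) -normrM mulrBr.
    rewrite mulrA divff ?gt_eqF // mul1r ger0_norm ?subr_ge0 //.
    apply: (@le_trans _ _ 1).
      rewrite lerBlDr -lerBlDl; apply: zS.
      rewrite natrX expr2 ler_pM2l //; apply: ltW.
      by near: n; apply: near_ltr_natS.
    rewrite -ler_pdivrMr //; apply: ltW.
    by near: n; apply: near_ltr_natS.
  - exact: integrable_norm.
  - move=> n s /=; rewrite in_itv/= => sab; rewrite layE //.
    have nz0 : 0 <= n.+1%:R * h s by rewrite mulr_ge0 // h0.
    have [S0 Sz _] := layer_count (n.+1 ^ 2) nz0.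
    rewrite [leLHS]normrM [leRHS]normrM ler_wpM2r //.
    rewrite !ger0_norm ?h0 // ?mulr_ge0 ?invr_ge0 //.
    by rewrite ler_pdivrMl ?ltr0Sn.
rewrite -(cvg_lim (@Rhausdorff R) lim); apply: limr_ge.
  by apply/cvg_ex; eexists; exact: lim.
by apply: nearW => n; have [] := intlay n (n.+1 ^ 2)%N.
Unshelve. all: by end_near. Qed.

End MonotoneWeight.

(** * Positivity of the Gamma function on ]0, 1] *)

Section GammaPositive.
Context {R : realType}.
Local Notation mu := (@lebesgue_measure R).
Implicit Types (z s : R).

Let integrand z s := s `^ (z - 1) * expR (- s).

Let continuous_integrand z : {in `]0, +oo[, continuous (integrand z)}.
Proof.
move=> s s0.
have cpow : {for s, continuous (fun x : R => x `^ (z - 1))}.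
  apply/differentiable_continuous/derivable1_diffP.
  exact: derivable_powR.
apply: cvgM; first exact: cpow.
apply: (@continuous_comp _ _ _ (@GRing.opp R) expR).
  exact: opp_continuous.
exact: continuous_expR.
Qed.

(** Integration by parts: z s^(z-1) e^(-s) = (s^z e^(-s))' + s^z e^(-s), and as
    z <= 1 the last term is at most (1 + s) e^(-s) = (- (2 + s) e^(-s))'.  The
    integrand is therefore dominated by the derivative of a bounded function. *)
Let primitive z s := z^-1 * (s `^ z * expR (- s) - (2 + s) * expR (- s)).

Let dprimitive z s :=
  integrand z s + z^-1 * ((1 + s - s `^ z) * expR (- s)).

Let is_derive_primitive z s : 0 < z -> 0 < s ->
  is_derive s 1 (primitive z) (dprimitive z s).
Proof.
move=> z0 s0.
have dexp : is_derive s 1 (fun s => expR (- s)) (- expR (- s)).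
  have := @is_derive1_comp _ expR (fun s => - s) s _ _ (is_derive_expR _)
    (is_deriveNid s (1 : R)).
  by rewrite mulrN1.
have dpow := is_derive1_powR z s0.
have dlin : is_derive s 1 (fun s => 2 + s) 1.
  have -> : (fun s => 2 + s) = (fun s => 1 * s + 2).
    by apply/funext => y; rewrite mul1r addrC.
  exact: is_derive_affine.
have := is_deriveZ z^-1
  (is_deriveB (is_deriveM dpow dexp) (is_deriveM dlin dexp)).
congr is_derive; rewrite /dprimitive /integrand /GRing.scale/=; field.
by rewrite gt_eqF.
Qed.

Let powR_le1D z s : 0 <= z <= 1 -> 0 < s -> s `^ z <= 1 + s.
Proof.
move=> /andP[z0 z1] s0; have [s1|/ltW s1] := leP s 1.
  apply: (@le_trans _ _ 1); last by rewrite lerDl ltW.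
  have := ge0_ler_powR z0 (ltW s0) ler01 s1.
  by rewrite powR1.
by apply: le_trans (ler1_powR s1 z1) _; rewrite lerDr.
Qed.

Let primitive_bounds z s : 0 < z <= 1 -> 0 < s ->
  - (2 / z) <= primitive z s <= 1 / z.
Proof.
move=> /andP[z0 z1] s0; have z01 : 0 <= z <= 1 by rewrite ltW.
have sz := powR_le1D z01 s0.
have e1 : (1 + s) * expR (- s) <= 1.
  rewrite expRN ler_pdivrMr ?expR_gt0 // mul1r; exact: expR_ge1Dx.
have e0 := expR_ge0 (- s); have p0 := powR_ge0 s z.
rewrite /primitive ler_pdivlMr // mulrAC mulVf ?gt_eqF // mul1r.
rewrite ler_pdivlMl // mulrN mulrCA divff ?gt_eqF // mulr1.
move: (expR _) (s `^ z) e1 e0 p0 sz => e p e1 e0 p0 sz.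
by apply/andP; split; nra.
Qed.

(** The integral is a total function that would be 0 if it diverged, so its
    positivity includes its convergence.  The upper bound 3 / z comes from the
    primitive, uniformly on the intervals [1/(n+1), n+2] that exhaust ]0, +oo[;
    the lower bound from the interval [1, 2]. *)
Lemma euler_gamma_gt0 z : 0 < z <= 1 -> 0 < euler_gamma z.
Proof.
move=> /[dup] z01' /andP[z0 z1].
have z01 : 0 <= z <= 1 by rewrite ltW.
have f0 s : 0 <= integrand z s by rewrite mulr_ge0 ?powR_ge0 ?expR_ge0.
pose F (n : nat) : set R := `[n.+1%:R^-1, n.+2%:R]%classic.
have Fpos n s : F n s -> 0 < s.
  by rewrite /F/= in_itv/= => /andP[+ _]; apply: lt_le_trans; rewrite invr_gt0.
have cf n : {within F n, continuous (integrand z)}.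
  apply/continuous_in_subspaceT => s /set_mem/Fpos s0.
  by apply: continuous_integrand; rewrite in_itv/= s0.
have mf n := measurable_int mu (continuous_integrable (cf n)).
have UF : \bigcup_n F n = `]0, +oo[%classic.
  apply/seteqP; split=> [s [n _ /Fpos s0]|s]; rewrite /= in_itv/= andbT.
    by rewrite s0.
  move=> s0; have [n [sn sVn]] : exists n, s < n.+1%:R /\ s^-1 < n.+1%:R.
    have [n] := filter_ex (filterI (near_ltr_natS s) (near_ltr_natS s^-1)).
    by exists n.
  exists n => //; rewrite /F/= in_itv/=; apply/andP; split; last first.
    by apply: ltW (lt_trans sn _); rewrite ltr_nat.
  by rewrite invf_ple ?posrE ?ltr0Sn // ltW.
have ndF : nondecreasing_seq F.
  apply/nondecreasing_seqP => n; rewrite subsetEset; apply: subset_itv.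
    by rewrite bnd_simp lef_pV2 ?posrE ?ltr0Sn // ler_nat.
  by rewrite bnd_simp ler_nat.
have lim := @ge0_nondecreasing_set_cvg_integral _ (measurableTypeR R) R F
  (EFin \o integrand z) mu ndF (fun=> measurable_itv _) mf (fun _ s _ => f0 s).
rewrite UF in lim.
have bound n : (\int[mu]_(s in F n) (integrand z s)%:E <= (3 / z)%:E)%E.
  have cF s : 0 < s -> {for s, continuous (primitive z)}.
    move=> s0; apply/differentiable_continuous/derivable1_diffP.
    by have [] := is_derive_primitive z0 s0.
  have cd : {within F n, continuous (dprimitive z)}.
    apply/continuous_in_subspaceT => s /set_mem/Fpos s0.
    apply: cvgD; first by apply: continuous_integrand; rewrite in_itv/= s0.
    apply: cvgM; first exact: cvg_cst.
    have cpow : {for s, continuous (fun x : R => x `^ z)}.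
      apply/differentiable_continuous/derivable1_diffP.
      by apply: derivable_powR; rewrite in_itv/= s0.
    apply: cvgM; last first.
      apply: (@continuous_comp _ _ _ (@GRing.opp R) expR).
        exact: opp_continuous.
      exact: continuous_expR.
    apply: cvgB; last exact: cpow.
    by apply: cvgD; [exact: cvg_cst|exact: cvg_id].
  have ab : n.+1%:R^-1 < n.+2%:R :> R.
    by rewrite (@le_lt_trans _ _ 1) ?invf_le1 ?ler1n ?ltr1n ?ltr0Sn.
  have a0 : 0 < n.+1%:R^-1 :> R by rewrite invr_gt0 ltr0Sn.
  apply: (@le_trans _ _ (\int[mu]_(s in F n) (dprimitive z s)%:E)%E).
    apply: le_integral; first exact: measurable_itv.
    - exact: (continuous_integrable (cf n)).
    - exact: (continuous_integrable cd).
    move=> s /set_mem/Fpos s0; rewrite lee_fin lerDl.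
    rewrite !mulr_ge0 ?expR_ge0 ?invr_ge0 ?(ltW z0) //.
    by rewrite subr_ge0 powR_le1D.
  rewrite (@continuous_FTC2 _ _ (primitive z)) //.
  - rewrite -EFinB lee_fin.
    have /andP[_ P1] := primitive_bounds z01' (ltr0Sn R n.+1).
    have /andP[P2 _] := primitive_bounds z01' a0.
    have -> : 3 / z = 1 / z + 2 / z by rewrite -mulrDl; congr (_ / _); lra.
    lra.
  - split.
    + move=> s; rewrite in_itv/= => /andP[as_ _].
      by have [] := is_derive_primitive z0 (lt_trans a0 as_).
    + by apply: cvg_at_right_filter; exact: cF.
    + by apply: cvg_at_left_filter; exact: cF.
  - move=> s; rewrite in_itv/= => /andP[as_ _]; rewrite derive1E.
    exact/derive_val/is_derive_primitive/(lt_trans a0 as_).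
have fin : (\int[mu]_(s in `]0%R, +oo[) (integrand z s)%:E <= (3 / z)%:E)%E.
  by apply: (cvge_le _ lim); exact: nearW.
have low : ((2^-1 * expR (- 2))%:E <=
    \int[mu]_(s in `]0%R, +oo[) (integrand z s)%:E)%E.
  have m12 : measurable (`[1, 2] : set R) by [].
  apply: (@le_trans _ _ (\int[mu]_(s in `[1%R, 2%R]) (integrand z s)%:E)%E).
    have -> : (2^-1 * expR (- 2))%:E =
        (\int[mu]_(s in `[1%R, 2%R]) (2^-1 * expR (- 2))%:E)%E :> \bar R.
      rewrite integral_cst //= lebesgue_measure_itv/= lte_fin ltr1n/=.
      by rewrite -EFinB -EFinM; congr EFin; lra.
    apply: le_integral => //.
    - by apply: continuous_integrable => s; exact: cvg_cst.
    - apply: continuous_integrable; apply/continuous_in_subspaceT => s /set_mem/=.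
      rewrite in_itv/= => /andP[s1 _]; apply: continuous_integrand.
      by rewrite in_itv/= (lt_le_trans _ s1).
    move=> s /set_mem/=; rewrite in_itv/= => /andP[s1 s2].
    have s0 : 0 < s by exact: lt_le_trans s1.
    rewrite lee_fin ler_pM ?expR_ge0 ?ler_expR ?lerN2 //.
    apply: (@le_trans _ _ (s `^ (- 1))).
      by rewrite powR_inv1 ?(ltW s0) // lef_pV2 ?posrE.
    by rewrite ler_powR // lerBrDr addrC subrr ltW.
  apply: ge0_subset_integral => //.
  - have mpow := @measurable_powR R (z - 1).
    have mexp := measurableT_comp (@measurable_expR R) (@oppr_measurable R setT).
    have /measurable_EFinP mI := measurable_funM mpow mexp.
    exact: measurable_funTS mI.
  - by move=> s _; rewrite lee_fin.
  - move=> s /=; rewrite !in_itv/= andbT => /andP[s1 _]; exact: lt_le_trans s1.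
rewrite /euler_gamma /Rintegral fine_gt0 //; apply/andP; split.
  by apply: lt_le_trans low; rewrite lte_fin mulr_gt0 ?expR_gt0.
by apply: le_lt_trans fin _; rewrite ltry.
Qed.

End GammaPositive.

(** * The fractional derivative at a maximum *)

Section HadamardMaximum.
Context {R : realType}.
Local Notation mu := (@lebesgue_measure R).
Implicit Types (f g : R -> R) (a b r s t T alpha : R).

(** On a bounded interval, |y| <= 1 + y^2 suffices. *)
Lemma square_integrable_integrable a b g : square_integrable a b g ->
  mu.-integrable `[a, b] (EFin \o g).
Proof.
move=> g2.
have /andP[/[!inE]/= mg _] := g2.
have ig2 := Lfun2_integrable_sqr g2.
have mab : measurable (`[a, b]%classic : set (measurableTypeR R)) by [].
suff : mu.-integrable `[a, b] (EFin \o (g \_ `[a, b])).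
  by apply: eq_integrable => // s sab; rewrite /= patchE sab.
have i1 : mu.-integrable `[a, b] (EFin \o (cst (1 : R))).
  by apply: continuous_integrable => s; exact: cvg_cst.
have ig2' : mu.-integrable `[a, b] (EFin \o (fun s => (g \_ `[a, b]) s ^+ 2)).
  by apply: integrableS ig2.
have := Rintegrable_add mab i1 ig2'.
apply: le_integrable => //.
  by apply/measurable_EFinP; exact: measurable_funTS.
move=> s _; rewrite lee_fin; set y := _ s.
rewrite [leRHS]ger0_norm ?addr_ge0 ?sqr_ge0 //=.
rewrite -[y ^+ 2]real_normK ?num_real //.
have := normr_ge0 y; nra.
Qed.

Lemma sobolev_derivativeP a b f : sobolev_W12 a b f ->
  is_sobolev_derivative a b f (sobolev_derivative a b f).
Proof. by move=> [_ [g fg]]; exact: (xgetPex _ (ex_intro _ g fg)). Qed.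

Lemma sobolev_derivative_integrable a b f : sobolev_W12 a b f ->
  mu.-integrable `[a, b] (EFin \o sobolev_derivative a b f).
Proof. by move=> /sobolev_derivativeP[/square_integrable_integrable]. Qed.

Lemma Rintegral_sobolev_derivative a b r t f : a <= r -> r < t -> t <= b ->
  {within `[a, b], continuous f} -> sobolev_W12 a b f ->
  \int[mu]_(s in `[r, t]) sobolev_derivative a b f s = f t - f r.
Proof.
move=> ar rt tb cf Wf; have [_ weak] := sobolev_derivativeP Wf.
have ig := sobolev_derivative_integrable Wf.
exact: Rintegral_weak_derivative ar rt tb cf ig weak.
Qed.

Lemma hadamard_kernel_nondecreasing alpha t s s' : 0 < alpha -> 0 < s ->
  s <= s' -> s' < t -> ln (t / s) `^ (- alpha) <= ln (t / s') `^ (- alpha).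
Proof.
move=> al0 s0 ss' s't; have s'0 := lt_le_trans s0 ss'.
have t0 := lt_trans s'0 s't.
have ts' : 0 < ln (t / s') by rewrite ln_gt0 // ltr_pdivlMr // mul1r.
have ss : ln (t / s') <= ln (t / s).
  by rewrite ler_ln ?posrE ?divr_gt0 // ler_pM2l // lef_pV2 ?posrE.
have ts := lt_le_trans ts' ss.
rewrite !powRN lef_pV2 ?posrE ?powR_gt0 //.
by rewrite ge0_ler_powR ?nnegrE // ltW.
Qed.

(** The extremum principle for the fractional derivative.  Put w = f1 - f2, with
    weak derivative g, and k for the kernel.  As w is maximal at t, the tail
    integrals w t - w r of g are nonnegative, and as k increases on [1, t[, the
    integral of (k - k 1) g is nonnegative.  What remains is
    k 1 * (w t - w 1) > 0. *)
Lemma hadamard_derivative_lt alpha T t f1 f2 : 0 < alpha < 1 -> 1 < t <= T ->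
  {within `[1, T], continuous f1} -> {within `[1, T], continuous f2} ->
  sobolev_W12 1 T f1 -> sobolev_W12 1 T f2 ->
  mu.-integrable `[1, t] (EFin \o hadamard_integrand alpha T f1 t) ->
  mu.-integrable `[1, t] (EFin \o hadamard_integrand alpha T f2 t) ->
  (forall s, 1 <= s <= t -> f1 s - f2 s <= f1 t - f2 t) ->
  f1 1 - f2 1 < f1 t - f2 t ->
  hadamard_derivative alpha T f2 t < hadamard_derivative alpha T f1 t.
Proof.
move=> /andP[al0 al1] /andP[t1 tT] cf1 cf2 W1 W2 i1 i2 max gt1.
pose g1 := sobolev_derivative 1 T f1; pose g2 := sobolev_derivative 1 T f2.
have sub : `[1, t] `<=` `[1, T].
  by apply: subset_itvl; rewrite bnd_simp.
have m1t : measurable (`[1, t]%classic : set (measurableTypeR R)) by [].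
have m1T : measurable (`[1, T]%classic : set (measurableTypeR R)) by [].
have ig1 := integrableS m1T m1t sub (sobolev_derivative_integrable W1).
have ig2 := integrableS m1T m1t sub (sobolev_derivative_integrable W2).
have ig := Rintegrable_sub m1t ig1 ig2.
have tail r : 1 <= r < t -> \int[mu]_(s in `[r, t]) (g1 s - g2 s) =
    (f1 t - f2 t) - (f1 r - f2 r).
  move=> /andP[r1 rt].
  have sub' : `[r, t] `<=` `[1, t] by apply: subset_itvr; rewrite bnd_simp.
  have mrt : measurable (`[r, t]%classic : set (measurableTypeR R)) by [].
  rewrite RintegralB //; [|exact: integrableS ig1|exact: integrableS ig2].
  by rewrite !Rintegral_sobolev_derivative //; ring.
pose k s := ln (t / s) `^ (- alpha).
have lnt : 0 < ln t by rewrite ln_gt0.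
have k1 : 0 < k 1 by rewrite powR_gt0 // divr1.
have ikg := Rintegrable_sub m1t i1 i2.
have subo : `[1, t[ `<=` `[1, t].
  by move=> s /=; rewrite !in_itv/= => /andP[-> /ltW].
have mo : measurable (`[1, t[%classic : set (measurableTypeR R)) by [].
have igo := integrableS m1t mo subo ig.
have ikgo := integrableS m1t mo subo ikg.
have ihg : mu.-integrable `[1, t[
    (EFin \o (fun s => (k s - k 1) * (g1 s - g2 s))).
  have := Rintegrable_sub mo ikgo (Rintegrable_scale (k 1) mo igo).
  apply: eq_integrable => // s _ /=; congr EFin.
  by rewrite /hadamard_integrand -/g1 -/g2 -/(k s); ring.
have tail0 r : 1 <= r < t -> 0 <= \int[mu]_(s in `[r, t]) (g1 s - g2 s).
  move=> rt; rewrite tail // subr_ge0 max //.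
  by case/andP: rt => -> /ltW.
have kmon s s' : 1 <= s -> s <= s' -> s' < t -> k s <= k s'.
  move=> s1; apply: hadamard_kernel_nondecreasing => //.
  exact: lt_le_trans s1.
have := Rintegral_nondecreasing_weight_ge0 ig tail0 _ _ ihg => hg.
have {}hg : 0 <= \int[mu]_(s in `[1, t[) ((k s - k 1) * (g1 s - g2 s)).
  apply: hg => [s /andP[s1 st]|s s' s1 ss' s't].
    by rewrite subr_ge0 kmon.
  by rewrite lerD2r kmon.
rewrite /hadamard_derivative ltr_pM2l; last first.
  by rewrite invr_gt0 euler_gamma_gt0 // subr_gt0 al1 gerBl ltW.
rewrite -subr_gt0 -RintegralB //.
have -> : \int[mu]_(s in `[1, t])
    (hadamard_integrand alpha T f1 t s - hadamard_integrand alpha T f2 t s) =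
    \int[mu]_(s in `[1, t[) ((k s - k 1) * (g1 s - g2 s)) +
    k 1 * \int[mu]_(s in `[1, t]) (g1 s - g2 s).
  (* At s = t the kernel has the value 0 and breaks monotonicity, hence the
     passage to the half-open interval. *)
rewrite -!Rintegral_itv_bndo_bndc // -RintegralZl // -RintegralD //.
    apply: eq_Rintegral => s _.
    by rewrite /hadamard_integrand -/g1 -/g2 -/(k s); ring.
  exact: Rintegrable_scale.
by rewrite ltr_wpDl // mulr_gt0 // tail ?lexx // subr_gt0.
Qed.

End HadamardMaximum.

(** * The second derivative test along a line *)

Section SecondDerivativeTest.
Context {R : realType}.

(** Directional derivatives along v are ordinary derivatives on the line through
    x, at every point of that line and not only at x. *)
Lemma is_derive_line (V : normedModType R) (f : V -> R) (x v : V) (h : R) :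
  derivable f (h *: v + x) v ->
  is_derive h 1 (fun h => f (h *: v + x)) ('D_v f (h *: v + x)).
Proof.
move=> df; pose p h := f (h *: v + x).
have E : (fun k : R => k^-1 *: ((p \o shift h) (k *: 1) - p h)) =
    (fun k => k^-1 *: ((f \o shift (h *: v + x)) (k *: v) - f (h *: v + x))).
  apply/funext => k; rewrite /p /= [k *: 1]mulr1 scalerDl.
  by rewrite addrA.
by apply: DeriveDef; rewrite /derivable /derive E.
Qed.

(** Were the second derivative positive, the first derivative, which vanishes at
    the maximum, would be positive just after it, and by the mean value theorem
    the function would exceed its maximum. *)
Lemma derive2_local_max_le0 (V : normedModType R) (f : V -> R) (x v : V) :
  (\forall y \near x, derivable f y v) -> derivable ('D_v f) x v ->
  (\forall y \near x, f y <= f x) -> 'D_v ('D_v f) x <= 0.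
Proof.
move=> nd d2 nmax; rewrite leNgt; apply/negP => d2_gt0.
pose p (h : R) := f (h *: v + x); pose q (h : R) := 'D_v f (h *: v + x).
have line0 : (h *: v + x) @[h --> (0 : R)] --> x.
  have : continuous (fun h : R => h *: v + x).
    by move=> h; apply: cvgD; [exact: scalel_continuous|exact: cvg_cst].
  by move=> /(_ 0); rewrite /continuous_at scale0r add0r.
have dq : (h^-1 * (q h - q 0)) @[h --> (0 : R)^'] --> 'D_v ('D_v f) x.
  have [d2q <-] : is_derive (0 : R) 1 q ('D_v ('D_v f) x).
    have E0 : 0 *: v + x = x by rewrite scale0r add0r.
    rewrite -[X in is_derive _ _ _ ('D_v _ X)]E0.
    by apply: is_derive_line; rewrite E0.
  have : (fun h : R => h^-1 *: ((q \o shift 0) (h *: 1) - q 0)) @ 0^' -->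
    'D_1 q 0 := d2q.
  apply: cvg_trans; apply: near_eq_cvg; near=> h => /=.
  by rewrite [h *: 1]mulr1 addr0.
have near_all : \forall h \near (0 : R), [/\ derivable f (h *: v + x) v,
    p h <= p 0 & h != 0 -> 0 < h^-1 * (q h - q 0)].
  near=> h; split.
  - by near: h; exact: line0 nd.
  - by rewrite /p scale0r add0r; near: h; exact: line0 nmax.
  - near: h; exact: (cvgr_gt _ dq _ d2_gt0).
have [e /= e0 near_e] : exists2 e : R, 0 < e & forall h, `|h| < e ->
    [/\ derivable f (h *: v + x) v, p h <= p 0 &
        h != 0 -> 0 < h^-1 * (q h - q 0)].
  move/nbhs_ballP : near_all => [e e0 he]; exists e => [|h he']; first exact: e0.
  by apply: he; rewrite /ball/= sub0r normrN.
have dp (h : R) : `|h| < e -> is_derive h 1 p (q h).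
  by move=> /near_e[dh _ _]; exact: is_derive_line.
have itv_e (h : R) : h \in `]- e, e[ -> `|h| < e by rewrite in_itv/= ltr_norml.
have q0 : q 0 = 0.
  have dp0 : is_derive (0 : R) 1 p 0.
    apply: (@derive1_at_max _ p (- e) e 0).
    - by rewrite ge0_cp // ltW.
    - by move=> h /itv_e/dp[].
    - by rewrite in_itv/= oppr_lt0 e0.
    - by move=> h /itv_e/near_e[].
  have [_ dp0E] := dp0; have [_ dpE] : is_derive (0 : R) 1 p (q 0).
    by apply: dp; rewrite normr0.
  by rewrite -dpE.
have e2 : 0 < e / 2 by rewrite divr_gt0.
have small (h : R) : 0 <= h <= e / 2 -> `|h| < e.
  by move=> /andP[h0 he]; rewrite ger0_norm //; lra.
have [c] : exists2 c, c \in `]0, e / 2[ & p (e / 2) - p 0 = q c * (e / 2 - 0).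
  apply: (@MVT R p q 0 (e / 2) e2).
    move=> h; rewrite in_itv/= => /andP[h0 he]; apply/dp/small.
    by rewrite !ltW.
  apply: derivable_within_continuous => h; rewrite in_itv/= => h0.
  by have [] := dp _ (small _ h0).
rewrite in_itv/= => /andP[c0 ce]; rewrite subr0 => mvt.
have he : 0 <= e / 2 <= e / 2 by rewrite ltW /=.
have [_ pmax _] := near_e _ (small _ he).
have hc : 0 <= c <= e / 2 by rewrite !ltW.
have [_ _ /(_ (lt0r_neq0 c0))] := near_e _ (small _ hc).
rewrite q0 subr0 pmulr_rgt0 ?invr_gt0 // => qc0.
have : 0 < p (e / 2) - p 0 by rewrite mvt mulr_gt0.
by rewrite subr_gt0 ltNge pmax.
Unshelve. all: by end_near. Qed.

End SecondDerivativeTest.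

(** * The maximum principle and uniqueness *)

Section MaximumPrinciple.
Context {R : realType} {n : nat}.
Local Notation mu := (@lebesgue_measure R).
Implicit Types (f g : 'rV[R]_n -> R) (G : set 'rV[R]_n).

(** The second derivative test for f - g, in each coordinate direction. *)
Lemma laplacian_le_at_max G f g (x : 'rV[R]_n) : open G -> class_C 2 G f ->
  class_C 2 G g -> G x -> (forall y, G y -> f y - g y <= f x - g x) ->
  laplacian f x <= laplacian g x.
Proof.
move=> oG Cf Cg Gx max; apply: ler_sum => j _.
have nG : \forall y \near x, G y by exact: open_nbhs_nbhs.
set e : 'rV[R]_n := delta_mx 0 j.
have df h y : class_C 2 G h -> G y -> derivable h y e.
  by move=> Ch Gy; have [_ ] := Ch [::] isT y Gy; exact.
have ddf h y : class_C 2 G h -> G y -> derivable (partial j h) y e.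
  by move=> Ch Gy; have [_ ] := Ch [:: j] isT y Gy; exact.
have nE : \forall y \near x,
    'D_e f y - 'D_e g y = 'D_e (fun y => f y - g y) y.
  near=> y; have Gy : G y by near: y.
  by rewrite -deriveB //; exact: df.
have ddB : derivable (fun y => partial j f y - partial j g y) x e.
  by apply: derivableB; exact: ddf.
rewrite -subr_le0 -deriveB; [|exact: ddf|exact: ddf].
rewrite (near_eq_derive e nE).
apply: derive2_local_max_le0.
- near=> y; have Gy : G y by near: y.
  by apply: derivableB; exact: df.
- exact: near_eq_derivable nE ddB.
- by near=> y; apply: max; near: y.
Unshelve. all: by end_near. Qed.

Lemma compact_closure G : bounded_set G -> compact (closure G).
Proof.
move=> bG; apply: bounded_closed_compact; last exact: closed_closure.
have [M M0 GM] : exists2 M : R, 0 < M & forall y, G y -> `|y| <= M.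
  have [M [Mreal GM]] := bG; exists (`|M| + 1); first by rewrite ltr_wpDl.
  by apply: GM; rewrite (le_lt_trans (ler_norm M)) // ltrDl.
have ballE (y : 'rV[R]_n) : closed_ball 0 M y = (`|y| <= M) :> Prop.
  by rewrite closed_ballE // /closed_ball_/= sub0r normrN.
have sub y : closure G y -> `|y| <= M.
  move=> Gy; rewrite -ballE; apply: (closed_ball_closed (x := 0) (r := M)).
  by apply: closureS Gy => z Gz; rewrite ballE GM.
exists M; split; first exact: num_real.
by move=> N MN y /sub yM; exact: le_trans yM (ltW MN).
Qed.

Lemma continuous_time_slice (A : set 'rV[R]_n) (T : R) u x :
  continuous_on_cylinder A T u -> A x -> {within `[1, T], continuous (u x)}.
Proof.
move=> /subspace_continuousP cu Ax; apply/subspace_continuousP => t tT.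
apply: (cvg_comp (fun s => (x, s)) (fun p => u p.1 p.2) _ (cu (x, t) _)) => //.
move=> B; rewrite /within/= => [[[B1 B2] /= [B1x B2t] BB]].
apply: filterS B2t => s B2s sT; apply: (BB (x, s)) => //=.
by split=> //=; exact: nbhs_singleton.
Qed.

(** Were u1 - u2 positive somewhere, its maximum over the compact cylinder would
    be positive, hence attained at some x0 in G and t0 > 1 by the initial and
    boundary conditions.  There the laplacian of u1 is at most that of u2, while
    its fractional derivative is strictly larger; both satisfy the same
    equation. *)
Lemma classical_solution_le alpha nu T G F phi psi u1 u2 :
  0 < alpha < 1 -> 0 < nu -> bounded_domain G ->
  classical_solution alpha nu T G F phi psi u1 ->
  classical_solution alpha nu T G F phi psi u2 ->
  forall x t, closure G x -> 1 <= t <= T -> u1 x t <= u2 x t.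
Proof.
move=> al nu0 [oG _ _ bG] [c1 [C1 [W1 [i1 [E1 [I1 B1]]]]]].
move=> [c2 [C2 [W2 [i2 [E2 [I2 B2]]]]]] x t Gx tT.
rewrite leNgt; apply/negP => lt21.
pose K := closure G `*` `[1, T]%classic.
have K0 : K !=set0 by exists (x, t).
have cK : compact K.
  by apply: compact_setX; [exact: compact_closure|exact: segment_compact].
have cw : {within K, continuous (fun p => u1 p.1 p.2 - u2 p.1 p.2)}.
  by move=> p; apply: cvgB; [exact: c1|exact: c2].
have [[x0 t0] /set_mem[/= Gx0 t0T] max] := compact_EVT_max K0 cK cw.
have {}max y s : closure G y -> 1 <= s <= T ->
    u1 y s - u2 y s <= u1 x0 t0 - u2 x0 t0.
  by move=> Gy sT; apply: (max (y, s)); apply/mem_set; split => //=.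
have w0 : 0 < u1 x0 t0 - u2 x0 t0.
  by apply: lt_le_trans (max _ _ Gx tT); rewrite subr_gt0.
move: t0T; rewrite /= in_itv/= => /andP[].
rewrite le_eqVlt => /orP[/eqP t1|t1] t0T.
  by move: w0; rewrite -t1 I1 // I2 // subrr ltxx.
have {}Gx0 : G x0.
  apply: contrapT => nGx0.
  have bx0 : boundary G x0 by split=> //; rewrite (interior_id _).1.
  by move: w0; rewrite B1 ?B2 ?subrr ?ltxx ?(ltW t1).
have t0T' : 1 < t0 <= T by rewrite t1.
have lap : laplacian (u1 ^~ t0) x0 <= laplacian (u2 ^~ t0) x0.
  apply: (laplacian_le_at_max oG (C1 _ t0T') (C2 _ t0T') Gx0) => y Gy.
  by apply: max; [exact: subset_closure|rewrite ltW].
have had : hadamard_derivative alpha T (u2 x0) t0 <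
    hadamard_derivative alpha T (u1 x0) t0.
  have Gx0' := subset_closure Gx0.
  apply: hadamard_derivative_lt => //.
  - exact: continuous_time_slice c1 _.
  - exact: continuous_time_slice c2 _.
  - exact: W1.
  - exact: W2.
  - exact: i1.
  - exact: i2.
  - move=> s /andP[s1 st]; apply: max => //.
    by rewrite s1 (le_trans st).
  - by rewrite I1 // I2 // subrr.
move: had; rewrite E1 // E2 // ltrD2r ltr_pM2l // ltNge.
by rewrite lap.
Qed.

End MaximumPrinciple.

Unset Implicit Arguments.

Theorem theorem4p5 (R : realType) (n : nat) (alpha nu T : R)
    (G : set 'rV[R]_n) (F : 'rV[R]_n -> R -> R) (phi : 'rV[R]_n -> R)
    (psi : 'rV[R]_n -> R -> R)
    (n_gt0 : (0 < n)%N)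
    (alpha_bounds : 0 < alpha < 1) (nu_gt0 : 0 < nu) (T_gt1 : 1 < T)
    (G_domain : bounded_domain G) (G_smooth : smooth_boundary G)
    (F_cont : continuous_on_cylinder (closure G) T F)
    (phi_cont : {within closure G, continuous phi})
    (psi_cont : continuous_on_cylinder (boundary G) T psi)
    (u1 u2 : 'rV[R]_n -> R -> R)
    (u1_sol : classical_solution alpha nu T G F phi psi u1)
    (u2_sol : classical_solution alpha nu T G F phi psi u2) :
  forall x t, closure G x -> 1 <= t <= T -> u1 x t = u2 x t.
Proof.
move=> x t Gx tT; apply/eqP; rewrite eq_le; apply/andP; split.
  exact: (classical_solution_le alpha_bounds nu_gt0 G_domain u1_sol u2_sol).
exact: (classical_solution_le alpha_bounds nu_gt0 G_domain u2_sol u1_sol).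
Qed.
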